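(* Let $1\le k<n$, let $\lambda=(\lambda_1,\dots,\lambda_n)$ be a generalized partition, and let $x^{\pm}=(x_1,x_1^{-1},\dots,x_{n-k},x_{n-k}^{-1})$ and $y^{\pm}=(y_1,y_1^{-1},\dots,y_k,y_k^{-1})$. Then the functions ${\rm o}_{\lambda/\mu}$ satisfy the general branching rule $${\rm o}_\lambda(x^{\pm};y^{\pm})=\sum_{\mu=(\mu_1,\dots,\mu_{n-k})}{\rm o}_\mu(x^{\pm})\,{\rm o}_{\lambda/\mu}(y^{\pm}),$$ where the sum is over all generalized partitions $\mu=(\mu_1,\dots,\mu_{n-k})$.
   Context: A generalized partition $\lambda=(\lambda_1,\dots,\lambda_n)$ is a finite weakly decreasing sequence of nonnegative integers (zeros allowed; the number $n$ of entries is part of the data). For $x^\pm=(x_1,x_1^{-1},\dots,x_N,x_N^{-1})$, $h_m(x^{\pm})$ is defined by $\prod_{i=1}^N\frac{1}{(1-x_iz)(1-x_i^{-1}z)}=\sum_{m\in\mathbb Z}h_m(x^{\pm})z^m$ (so $h_m(x^\pm)=0$ for $m<0$). (Even) orthogonal Schur function: for a generalized partition $\lambda=(\lambda_1,\dots,\lambda_N)$ and $N$ variables, $${\rm o}_\lambda(x^{\pm})=2(-1)^{\frac{N(N-1)}2}\frac{\det\big(x_i^{-\lambda_j+j-N}+\epsilon_j\,x_i^{\lambda_j-j+N}\big)_{i,j=1}^N}{\det\big(x_i^{-j+1}+x_i^{j-1}\big)_{i,j=1}^N},$$ where $\epsilon_j=0$ if $j=N$ and $\lambda_N=0$, and $\epsilon_j=1$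 otherwise. Equivalently (Jacobi--Trudi formula), ${\rm o}_\lambda(x^\pm)=\det\big(h_{\lambda_i-i+j}(x^{\pm})-h_{\lambda_i-i-j}(x^{\pm})\big)_{1\le i,j\le N}$. ${\rm o}_\lambda(x^\pm;y^\pm)$ is this function in the $n$ variables $x_1,\dots,x_{n-k},y_1,\dots,y_k$. Skew orthogonal Schur function: for generalized partitions $\mu=(\mu_1,\dots,\mu_l)$ and $\lambda=(\lambda_1,\dots,\lambda_{l+N})$ and $x^\pm=(x_1^{\pm1},\dots,x_N^{\pm1})$, ${\rm o}_{\lambda/\mu}(x^{\pm})=\det(b_{ij})_{1\le i,j\le l+N}$, where $b_{ij}=h_{\lambda_i-\mu_j-i+j}(x^{\pm})$ for $1\le j\le l$ and $b_{ij}=h_{\lambda_i-i+j}(x^{\pm})-h_{\lambda_i-i-j+2l}(x^{\pm})$ for $l+1\le j\le l+N$. *)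

(* Defs.v *)
From HB Require Import structures.
From mathcomp Require Import all_boot all_order all_algebra.

Set Implicit Arguments.
Unset Strict Implicit.
Unset Printing Implicit Defensive.

Import GRing.Theory.
Local Open Scope ring_scope.

(* The entries of a partition and the variables are given as sequences, with  *)
(* 0-based indices: the i-th entry (i >= 1) of lam is lam`_(i.-1).  The       *)
(* matrices below are written with i.+1, j.+1 so that the formulas can be     *)
(* read with the usual 1-based indices.                                       *)
Definition gpartition (lam : seq nat) : bool := sorted geq lam.

Definition part (lam : seq nat) (i : nat) : int := (nth 0%N lam i)%:Z.

Section OrthogonalSchur.

Variable F : fieldType.
Implicit Types (x y : seq F) (lam mu : seq nat).

Definition geom (n : nat) (a : F) : {poly F} := \poly_(i < n) a ^+ i.

(* Coefficient of z^m in \prod_(a <- x) 1 / ((1 - a z) (1 - a^-1 z)).  The     *)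
(* geometric series can be truncated after degree m without changing this     *)
(* coefficient; hpm_genfun is the generating function identity.               *)
Definition hpm x (d : int) : F :=
  if d is Posz m then
    (\prod_(a <- x) (geom m.+1 a * geom m.+1 a^-1))`_m
  else 0.

Definition onum lam x : F :=
  let N := size x in
  \det (\matrix_(i < N, j < N)
    let e : int := part lam j - j.+1%:Z + N%:Z in
    x`_i ^ (- e)
    + (if (j.+1 == N) && (part lam j == 0) then 0 else 1) * x`_i ^ e).

Definition oden x : F :=
  let N := size x in
  \det (\matrix_(i < N, j < N)
    (x`_i ^ (- j.+1%:Z + 1) + x`_i ^ (j.+1%:Z - 1))).

Definition oschur lam x : F :=
  let N := size x in
  2 * (-1) ^+ ((N * (N - 1)) %/ 2) * (onum lam x / oden x).

(* Here l = size mu and N = size y; lam is meant to have l + N entries.       *)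
Definition oskew lam mu y : F :=
  let l := size mu in
  let N := size y in
  \det (\matrix_(i < l + N, j < l + N)
    if (j < l)%N then
      hpm y (part lam i - part mu j - i.+1%:Z + j.+1%:Z)
    else
      hpm y (part lam i - i.+1%:Z + j.+1%:Z)
      - hpm y (part lam i - i.+1%:Z - j.+1%:Z + (2 * l)%N%:Z)).

Lemma coefM_eq n (p q p' q' : {poly F}) :
    (forall i, (i < n)%N -> p`_i = p'`_i) ->
    (forall i, (i < n)%N -> q`_i = q'`_i) ->
  forall i, (i < n)%N -> (p * q)`_i = (p' * q')`_i.
Proof.
move=> Hp Hq i lt_in; rewrite !coefM; apply: eq_bigr => j _.
rewrite Hp ?Hq //; first exact: leq_ltn_trans (leq_subr _ _) lt_in.
by apply: leq_ltn_trans lt_in; rewrite -ltnS.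
Qed.

Lemma coef_prod_eq n x (f g : F -> {poly F}) :
    (forall a i, (i < n)%N -> (f a)`_i = (g a)`_i) ->
  forall i, (i < n)%N ->
    (\prod_(a <- x) f a)`_i = (\prod_(a <- x) g a)`_i.
Proof.
move=> Hfg; elim: x => [|a x IHx] i lt_in; first by rewrite !big_nil.
by rewrite !big_cons; apply: (coefM_eq (n := n)) => //; apply: Hfg.
Qed.

Lemma mul_geom n a : (1 - a *: 'X) * geom n a = 1 - a ^+ n *: 'X^n.
Proof.
elim: n => [|n IHn]; first by rewrite /geom poly_def big_ord0 mulr0 !expr0 scale1r subrr.
rewrite /geom poly_def big_ord_recr /= -poly_def mulrDr [X in X + _]IHn.
rewrite mulrBl mul1r -scalerAl -scalerAr -exprS scalerA -exprS.
by rewrite addrA subrK.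
Qed.

Lemma hpm_genfun x (m : nat) :
  \sum_(j < m.+1)
     (\prod_(a <- x) ((1 - a *: 'X) * (1 - a^-1 *: 'X)))`_j
     * hpm x (m - j)%N%:Z
  = (m == 0%N)%:R.
Proof.
have geomE n k a i : (i < n)%N -> (i < k)%N -> (geom n a)`_i = (geom k a)`_i.
  by move=> lin lik; rewrite /geom !coef_poly lin lik.
transitivity ((\prod_(a <- x) ((1 - a *: 'X) * (1 - a^-1 *: 'X))
               * \prod_(a <- x) (geom m.+1 a * geom m.+1 a^-1))`_m).
  rewrite coefM; apply: eq_bigr => j _; congr (_ * _).
  apply: (coef_prod_eq (n := (m - j).+1)) => // a.
  by apply: coefM_eq => i lt_i; apply: geomE => //;
     apply: (leq_trans lt_i); rewrite ltnS leq_subr.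
rewrite -big_split /=.
rewrite (@coef_prod_eq m.+1 x _ (fun=> 1)) //; last first.
  move=> a i lt_i; rewrite mulrACA !mul_geom -[1 in RHS]mulr1.
  by apply: (coefM_eq (n := m.+1)) => // k lt_k;
     rewrite coefB coefZ coefXn (ltn_eqF lt_k) mulr0 subr0.
by rewrite big1 // coef1.
Qed.

End OrthogonalSchur.

(* Main.v *)
Require Import Defs.
From HB Require Import structures.
From mathcomp Require Import all_boot all_order all_fingroup all_algebra.
From mathcomp Require Import ring zify.
From mathcomp Require Import boolp classical_sets cardinality fsbigop.

Set Implicit Arguments.
Unset Strict Implicit.
Unset Printing Implicit Defensive.

Import GRing.Theory.
Local Open Scope classical_set_scope.
Local Open Scope ring_scope.

(** Why the branching rule holds.

    Write w_a = a + a^-1, let h_d(y) be the coefficient [hpm y d], and let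
    c_e(a) = a^e + a^-e for e > 0, c_0(a) = 1.  With e_j = mu_j + l - j, the
    numerator of o_mu(x) in l variables is the determinant of the c_{e_j}(x_i),
    and the first l columns of the skew determinant o_{lam/mu}(y) are the
    vectors (h_{m_i - e_j}(y))_i, where m_i = lam_i - i + l; the last k
    columns, h_{m_i + s}(y) - h_{m_i - s}(y) for s = 1, ..., k, do not depend
    on mu.  Generalized partitions mu with l entries correspond to strictly
    decreasing exponents e_1 > ... > e_l >= 0, so a Cauchy-Binet formula for a
    matrix with extra columns ([cauchy_binet_bordered]) collapses the sum over
    mu to a single determinant ([mixdet_branching]).  Its first l columns are
    the convolutions of c_e(x_j) with h(y); as the generating function of the
    c_e(a) is (1 - z^2) / ((1 - a z)(1 - a^-1 z)), they equal
    h_m(x_j, y) - h_{m-2}(x_j, y) ([hpm_cons_conv]).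

    This mixed determinant, [mixdet], interpolates between the two sides.  When
    y is empty it is the numerator of o_lam(x).  The recurrence
    h_d(a, y) - w_a h_{d-1}(a, y) + h_{d-2}(a, y) = h_d(y) shows that moving one variable a from y to x is a
    triangular column operation which multiplies the determinant by
    \prod_j (w_{x_j} - w_a) ([mixdet_rcons]).  The denominator of o is twice the
    Vandermonde determinant in the w's ([oden_wvander]), so it changes by the
    same factor up to the sign (-1)^l, which is exactly the change of the sign
    (-1)^{l(l-1)/2} in front of the quotient ([schur_mix_rcons]).  Hence the
    normalized mixed determinant is unchanged when all of y is moved to x, and
    this is the theorem. *)

(** * Recurrences for the complete symmetric functions h_d *)

Section HpmTheory.
Variable F : fieldType.
Implicit Types (x y : seq F) (a b : F).

Definition wsum a : F := a + a^-1.

Lemma hpm_coef n y (d : nat) : (d < n)%N ->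
  hpm y d%:Z = (\prod_(a <- y) (geom n a * geom n a^-1))`_d.
Proof.
move=> lt_dn; apply: (@coef_prod_eq _ d.+1) => // a i lt_id.
by apply: (coefM_eq (n := d.+1)) => // j lt_j;
   rewrite /geom !coef_poly lt_j (leq_trans lt_j).
Qed.

Lemma hpm_neg y (d : int) : (d < 0)%R -> hpm y d = 0.
Proof. by case: d. Qed.

Lemma hpm_swap a b y d : hpm (a :: b :: y) d = hpm (b :: a :: y) d.
Proof. by case: d => // m; rewrite /hpm !big_cons mulrCA. Qed.

Lemma hpm_nil d : hpm [::] d = (d == 0)%:R :> F.
Proof. by case: d => // m; rewrite /hpm big_nil coef1. Qed.

(** Multiplying the generating function by (1 - a z)(1 - a^-1 z) removes the
    variable a, and this quadratic polynomial is 1 - w_a z + z^2. *)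
Lemma hpm_cons_rec a y d : a != 0 ->
  hpm (a :: y) d - wsum a * hpm (a :: y) (d - 1) + hpm (a :: y) (d - 2)
  = hpm y d.
Proof.
move=> a0; case: d => [m|m]; last first.
  by rewrite !hpm_neg ?mulr0 ?subr0 ?addr0//; lia.
pose P := \prod_(b <- y) (geom m.+1 b * geom m.+1 b^-1).
pose Q := \prod_(b <- a :: y) (geom m.+1 b * geom m.+1 b^-1).
have QP : ((1 - wsum a *: 'X + 'X^2) * Q)`_m = P`_m.
  have -> : 1 - wsum a *: 'X + 'X^2 = (1 - a *: 'X) * (1 - a^-1 *: 'X).
    rewrite mulrBl mul1r mulrBr mulr1 -scalerAl -scalerAr scalerA divff //.
    by rewrite scale1r -expr2 /wsum scalerDl; ring.
  rewrite /Q big_cons mulrA mulrACA !mul_geom.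
  transitivity ((1 * P)`_m); last by rewrite mul1r.
  apply: (coefM_eq (n := m.+1)) => // i lt_i.
  rewrite -[RHS](congr1 (fun p : {poly F} => p`_i) (mulr1 1)).
  apply: (coefM_eq (n := m.+1)) => // j lt_j;
  by rewrite coefB coefZ coefXn (ltn_eqF lt_j) mulr0 subr0.
rewrite (hpm_coef (n := m.+1) y) // -/P -QP [in RHS]mulrDl [in RHS]mulrBl.
rewrite mul1r coefD coefB.
rewrite -scalerAl coefZ coefXM coefXnM (hpm_coef (n := m.+1)) // -/Q.
case: m @P @Q {QP} => [|[|m]] P Q.
- by rewrite !hpm_neg.
- by rewrite (_ : 1%N%:Z - 1 = 0%N%:Z) // (hpm_coef (n := 2)) //.
have -> : m.+2%:Z - 1 = m.+1%:Z by lia.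
have -> : m.+2%:Z - 2 = m%:Z by lia.
by rewrite !(hpm_coef (n := m.+3)) ?subn2 //=; lia.
Qed.

(** These are the entries of the numerator of an orthogonal Schur function: the
    case e = 0 is where the epsilon of that numerator vanishes. *)
Definition csym a (e : nat) : F := if e == 0%N then 1 else a ^- e + a ^+ e.

(** Both sides satisfy u_{d+1} = w_a u_d - u_{d-1} from d = 2 on, so e = 1
    and e = 2 determine the rest; e = 0 is apart because c_0 is 1 and not 2. *)
Lemma csym_hpm a (e : nat) : a != 0 ->
  hpm [:: a] e%:Z - hpm [:: a] (e%:Z - 2) = csym a e.
Proof.
move=> a0.
have rec (d : int) : hpm [:: a] d - hpm [:: a] (d - 2) =
   (d == 0)%:R - (d - 2 == 0)%:R
   + wsum a * (hpm [:: a] (d - 1) - hpm [:: a] (d - 1 - 2))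
   - (hpm [:: a] (d - 2) - hpm [:: a] (d - 2 - 2)).
  rewrite -2!hpm_nil -(hpm_cons_rec [::] d a0) -(hpm_cons_rec [::] (d - 2) a0).
  rewrite (_ : d - 1 - 2 = d - 2 - 1); last by lia.
  ring.
have h0 : hpm [:: a] 0%:Z - hpm [:: a] (0%:Z - 2) = 1.
  by rewrite rec !(@hpm_neg [:: a]) //= !subr0 mulr0 addr0.
have h1 : hpm [:: a] 1%:Z - hpm [:: a] (1%:Z - 2) = wsum a.
  rewrite rec (_ : 1%:Z - 1 = 0%:Z) // h0 !(@hpm_neg [:: a]) //=. ring.
have h2 : hpm [:: a] 2%:Z - hpm [:: a] (2%:Z - 2) = wsum a * wsum a - 1 - 1.
  rewrite rec (_ : 2%:Z - 1 = 1%:Z) // (_ : 2%:Z - 2 = 0%:Z) // h0 h1 /=. ring.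
have [//|e_gt0] := posnP e; rewrite /csym; first by move=> ->.
rewrite -(prednK e_gt0) /=.
suff [] : (hpm [:: a] e.-1.+1%:Z - hpm [:: a] (e.-1.+1%:Z - 2)
            = a ^- e.-1.+1 + a ^+ e.-1.+1) /\
  (hpm [:: a] e.-1.+2%:Z - hpm [:: a] (e.-1.+2%:Z - 2)
            = a ^- e.-1.+2 + a ^+ e.-1.+2) by [].
elim: e.-1 => [|i [IH1 IH2]].
  by rewrite h1 h2 /wsum; split; [rewrite addrC | field].
split=> //; rewrite rec (_ : i.+3%:Z - 1 = i.+2%:Z); last by lia.
rewrite (_ : i.+3%:Z - 2 = i.+1%:Z) ; last by lia.
rewrite IH1 IH2 /wsum (_ : i.+3%:Z == 0 = false) //.
rewrite (_ : i.+1%:Z == 0 = false) //.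
rewrite !exprS; field.
by rewrite a0 expf_neq0.
Qed.

(** The h_d in the single variable b convolve with those in y to give those in
    b and y; [csym_hpm] turns this into the statement for the c_e. *)
Lemma hpm_cons_conv b y (m : int) n : b != 0 -> (m < n%:Z)%R ->
  \sum_(e < n) csym b e * hpm y (m - e%:Z)
  = hpm (b :: y) m - hpm (b :: y) (m - 2).
Proof.
move=> b0.
have conv (d : int) k : (d < k%:Z)%R ->
    \sum_(e < k) hpm [:: b] e%:Z * hpm y (d - e%:Z) = hpm (b :: y) d.
  case: d => [d|d] lt_dk; last first.
    rewrite [RHS]hpm_neg // big1 // => e _.
    by rewrite (@hpm_neg y) ?mulr0//; lia.
  rewrite (hpm_coef (n := d.+1)) // big_cons coefM.
  rewrite (big_ord_widen k (fun j => (geom d.+1 b * geom d.+1 b^-1)`_j *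
    (\prod_(j0 <- y) (geom d.+1 j0 * geom d.+1 j0^-1))`_(d - j))) //.
  rewrite [RHS]big_mkcond; apply: eq_bigr => e _; case: ifP => le_ed.
    rewrite (hpm_coef (n := d.+1)) // big_seq1.
    rewrite (_ : d%:Z - e%:Z = (d - e)%N%:Z); last by lia.
    by rewrite (hpm_coef (n := d.+1)) //; lia.
  by rewrite (@hpm_neg _ (d%:Z - e%:Z)) ?mulr0//; lia.
move=> lt_mn.
under eq_bigr => e _ do rewrite -csym_hpm // mulrBl.
rewrite sumrB conv //; congr (_ - _).
(* The shift by 2 in h_{e-2}(b) can be moved to the other factor. *)
case: n lt_mn => [|[|n]] lt_mn.
- by rewrite big_ord0 hpm_neg //; lia.
- by rewrite big_ord1 (@hpm_neg [:: b]) // (@hpm_neg (b :: y)) ?mul0r //; lia.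
rewrite !big_ord_recl !(@hpm_neg [:: b]) // !mul0r !add0r -(conv _ n); last by lia.
apply: eq_bigr => e _; congr (hpm _ _ * hpm _ _); rewrite /= /bump /=; lia.
Qed.
End HpmTheory.

(** * The mixed determinant and the denominator *)

Section MixedDeterminant.
Variable F : fieldType.
Implicit Types (x y : seq F) (a b : F).

(** Column j of the determinant that interpolates between o_lam(x, y), for y
    empty, and the right-hand side of the branching rule; m is the integer
    lam_i - i + l attached to a row, where l = size x. *)
Definition mixcol x y (j : nat) (m : int) : F :=
  if (j < size x)%N then hpm (x`_j :: y) m - hpm (x`_j :: y) (m - 2)
  else hpm y (m + (j.+1 - size x)%N%:Z) - hpm y (m - (j.+1 - size x)%N%:Z).

(** The row exponents e are those of the numerator in all the variables, so they
    do not change when a variable moves from y to x; the shift by [size y]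
    gives the argument of [mixcol]. *)
Definition mixdet (e : nat -> int) x y : F :=
  \det (\matrix_(i < size x + size y, j < size x + size y)
          mixcol x y j (e i - (size y)%:Z)).

Lemma det_mulT n (A B : nat -> nat -> F) (T : nat -> nat -> F) :
    (forall i j, (i < n)%N -> (j < n)%N ->
        B i j = \sum_(p < n) A i p * T p j) ->
    (forall i j, (i < j < n)%N -> T i j = 0) \/
    (forall i j, (j < i < n)%N -> T i j = 0) ->
  \det (\matrix_(i < n, j < n) B i j)
  = (\prod_(j < n) T j j) * \det (\matrix_(i < n, j < n) A i j).
Proof.
move=> BE trigT; pose TM : 'M_n := \matrix_(i < n, j < n) T i j.
have -> : \matrix_(i < n, j < n) B i j = (\matrix_(i < n, j < n) A i j) *m TM.
  by apply/matrixP=> i j; rewrite !mxE BE //; apply: eq_bigr => p _; rewrite !mxE.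
rewrite det_mulmx mulrC; congr (_ * _).
case: trigT => trigT; last rewrite -det_tr; rewrite det_trig.
- by apply: eq_bigr => i _; rewrite mxE.
- by apply/is_trig_mxP => i j lt_ij; rewrite mxE trigT // lt_ij /=.
- by apply: eq_bigr => i _; rewrite !mxE.
- by apply/is_trig_mxP => i j lt_ij; rewrite !mxE trigT // lt_ij /=.
Qed.

Lemma sum_delta n (G : nat -> F) q : (q < n)%N ->
  \sum_(p < n) G p * ((p : nat) == q)%:R = G q.
Proof.
move=> lt_qn; rewrite (bigD1 (Ordinal lt_qn)) //= eqxx mulr1 big1 ?addr0 // => p.
by rewrite -val_eqE /= => /negbTE ->; rewrite mulr0.
Qed.

(** The next three lemmas express the columns for (rcons x a, y) through those
    for (x, a :: y).  Here h_d(x_j, y) is obtained from h_d(x_j, a, y) by the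
    recurrence for a, and the recurrence for x_j identifies the remaining terms;
    the difference of the two recurrences leaves w_{x_j} - w_a. *)
Lemma mixcol_diff_rcons x y a j (m : int) : a != 0 -> x`_j != 0 ->
  (j < size x)%N ->
  mixcol (rcons x a) y j (m + 1) =
    (wsum (x`_j) - wsum a) * mixcol x (a :: y) j m + mixcol x (a :: y) (size x) m.
Proof.
move=> a0 xj0 lt_j; rewrite /mixcol size_rcons ltnS ltnW // nth_rcons lt_j ltnn.
rewrite subSnn; set b := x`_j.
pose h := hpm (b :: a :: y).
have rb d := hpm_cons_rec (a :: y) d xj0; rewrite -/b -/h in rb.
have ra d : h d - wsum a * h (d - 1) + h (d - 2) = hpm (b :: y) d.
  by rewrite /h !(hpm_swap b a) hpm_cons_rec.
rewrite -/h -!ra -!rb.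
rewrite (_ : m + 1 - 2 - 1 = m - 2); last by lia.
rewrite (_ : m + 1 - 1 = m); last by lia.
rewrite (_ : m - 1 - 1 = m - 2); last by lia.
rewrite (_ : m + 1 - 2 = m - 1); last by lia.
ring.
Qed.

Lemma mixcol_new_rcons x y a (m : int) :
  mixcol (rcons x a) y (size x) (m + 1) = mixcol x (a :: y) (size x) m.
Proof.
rewrite /mixcol size_rcons ltnSn ltnn nth_rcons ltnn eqxx subSnn.
by congr (_ - hpm _ _); lia.
Qed.

Lemma mixcol_old_rcons x y a s (m : int) : a != 0 ->
  mixcol (rcons x a) y (size x + s.+1) (m + 1) =
    mixcol x (a :: y) (size x + s.+1) m
    - wsum a * mixcol x (a :: y) (size x + s) m
    + (if s is s'.+1 then mixcol x (a :: y) (size x + s') m else 0).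
Proof.
move=> a0; have nlt p : (size x + p < size x)%N = false by lia.
have sz p : ((size x + p).+1 - size x = p.+1)%N by lia.
have szr : ((size x + s.+1).+1 - (size x).+1 = s.+1)%N by lia.
rewrite /mixcol size_rcons !nlt !sz szr -!(hpm_cons_rec y _ a0).
rewrite (_ : (size x + s.+1 < (size x).+1)%N = false); last by lia.
set h := hpm (a :: y).
have -> : m + 1 + s.+1%:Z - 1 = m + s.+1%:Z by lia.
have -> : m + 1 + s.+1%:Z = m + s.+2%:Z by lia.
have -> : m + 1 - s.+1%:Z - 1 = m - s.+1%:Z by lia.
have -> : m + 1 - s.+1%:Z - 2 = m - s.+2%:Z by lia.
have -> : m + 1 - s.+1%:Z = m - s%:Z by lia.
have -> : m + s.+2%:Z - 2 = m + s%:Z by lia.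
case: s {szr} => [|s]; first by rewrite !(addr0, subr0); ring.
by rewrite !nlt !sz; ring.
Qed.

(** The column operation is the product of two triangular ones: [T2] rewrites
    the columns that come from y and has ones on its diagonal; [T1] rewrites those
    that come from x, with the factors w_b - w_a on its diagonal. *)
Lemma mixdet_rcons e x y a : a != 0 -> (forall b, b \in x -> b != 0) ->
  mixdet e (rcons x a) y =
    (\prod_(b <- x) (wsum b - wsum a)) * mixdet e x (a :: y).
Proof.
move=> a0 x0; rewrite /mixdet size_rcons addSnnS /=.
set l := size x; set n := (l + _)%N.
pose m i : int := e i - (size y).+1%:Z.
have em i : e i - (size y)%:Z = m i + 1 by rewrite /m; lia.
pose G i j := mixcol x (a :: y) j (m i).
pose G' i j := mixcol (rcons x a) y j (m i + 1).
pose Gm i j := if (j <= l)%N then G i j else G' i j.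
pose T1 p j : F := if (j < l)%N then
     (p == j)%:R * (wsum x`_j - wsum a) + (p == l)%:R else (p == j)%:R.
pose T2 p j : F := if (j <= l)%N then (p == j)%:R else
   (p == j)%:R - (p == j.-1)%:R * wsum a +
   (if (j == l.+1)%N then 0 else (p == j - 2)%N%:R).
have -> : \matrix_(i < n, j < n) mixcol (rcons x a) y j (e i - (size y)%:Z) =
  \matrix_(i < n, j < n) G' i j by apply/matrixP=> i j; rewrite !mxE em.
have lt_ln : (l < n)%N by rewrite /n; lia.
rewrite (det_mulT (A := Gm) (B := G') (T := T1)).
- rewrite (det_mulT (A := G) (B := Gm) (T := T2)).
  + rewrite [X in _ * (X * _)]big1 ?mul1r => [|j _]; last first.
      rewrite /T2 eqxx; case: leqP => // lt_lj.
      rewrite (_ : (j == j.-1 :> nat) = false) ?mul0r ?subr0; last by lia.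
      case: ifP => _; first by rewrite addr0.
      by rewrite (_ : (j == j - 2 :> nat)%N = false) ?addr0; last by lia.
    congr (_ * _); rewrite (big_nth 0) big_mkord -/l.
    rewrite (big_ord_widen n (fun j => wsum x`_j - wsum a)); last exact: ltnW.
    rewrite [RHS]big_mkcond; apply: eq_bigr => j _; rewrite /T1 eqxx.
    by case: ltnP => // lt_jl; rewrite mul1r (ltn_eqF lt_jl) addr0.
  + move=> i j lt_in lt_jn; rewrite /Gm /T2; case: leqP => [le_jl|lt_lj].
      by rewrite sum_delta.
    under eq_bigr => p _ do rewrite mulrDr mulrBr mulrA.
    rewrite big_split sumrB -mulr_suml !sum_delta //=; try lia.
    rewrite /G /G' (_ : j = (l + (j - l.+1).+1)%N); last by lia.
    rewrite mixcol_old_rcons // (_ : (l + (j - l.+1).+1)%N = j); last by lia.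
    rewrite (_ : j.-1 = (l + (j - l.+1))%N); last by lia.
    rewrite [_ * wsum a]mulrC; congr (_ + _).
    case: (posnP (j - l.+1)) => [e0|gt0].
      rewrite e0 big1 // => p _; rewrite ifT ?mulr0 //; lia.
    rewrite -{1}(prednK gt0) (_ : (j == l.+1) = false); last by lia.
    under eq_bigr => p _ do rewrite -/(G i p).
    rewrite sum_delta; last by lia.
    by rewrite /G; congr mixcol; lia.
  right=> i j /andP[lt_ji lt_in]; rewrite /T2; case: leqP => le_jl.
    by rewrite (gtn_eqF lt_ji).
  rewrite !(gtn_eqF lt_ji) (_ : (i == j.-1) = false); last by lia.
  rewrite (_ : (i == j - 2)%N = false); last by lia.
  by rewrite if_same mul0r subr0 addr0.
- move=> i j lt_in lt_jn; rewrite /T1; case: ltnP => lt_jl.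
    under eq_bigr => p _ do rewrite mulrDr mulrA.
    rewrite big_split -mulr_suml !sum_delta //= /Gm (ltnW lt_jl) leqnn /G /G'.
    by rewrite mixcol_diff_rcons // ?x0 ?mem_nth // mulrC.
  rewrite sum_delta // /Gm; case: leqP => // le_jl.
  by rewrite (_ : j = l) /G /G' ?mixcol_new_rcons //; lia.
- left=> i j /andP[lt_ij lt_jn]; rewrite /T1 (ltn_eqF lt_ij) mul0r add0r.
  by case: ifP => // lt_jl; rewrite (_ : (i == l) = false) //; lia.
Qed.

Definition wvander x : F :=
  \prod_(i < size x) \prod_(j < size x | (i < j)%N) (wsum x`_j - wsum x`_i).

Lemma wvander_rcons x a :
  wvander (rcons x a) = wvander x * \prod_(b <- x) (wsum a - wsum b).
Proof.
rewrite /wvander size_rcons big_ord_recr /=.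
rewrite [X in _ * X]big1 => [|j lt_j]; last by have := ltn_ord j; lia.
rewrite mulr1 (big_nth 0) big_mkord -big_split; apply: eq_bigr => i _ /=.
rewrite big_mkcond big_ord_recr /= ltn_ord !nth_rcons ltnn eqxx ltn_ord.
congr (_ * _); rewrite -big_mkcond; apply: eq_bigr => j _.
by rewrite !nth_rcons !ltn_ord.
Qed.

(** Chebyshev polynomials, normalized so that the value at a + a^-1 is
    a^n + a^-n; they are monic except for the constant 2 in degree 0. *)
Fixpoint chebT (n : nat) : {poly F} :=
  match n with
  | 0 => 2%:P
  | 1 => 'X
  | S (S n2 as n1) => 'X * chebT n1 - chebT n2
  end.

Lemma chebT_eval n a : a != 0 -> (chebT n).[wsum a] = a ^- n + a ^+ n.
Proof.
move=> a0.
suff [] : (chebT n).[wsum a] = a ^- n + a ^+ n /\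
  (chebT n.+1).[wsum a] = a ^- n.+1 + a ^+ n.+1 by [].
elim: n => [|n [IH1 IH2]].
  split; first by rewrite hornerC !expr0 invr1.
  by rewrite hornerX !expr1 addrC.
split=> //; rewrite [chebT _]/= -/(chebT n.+1) hornerD hornerN hornerM hornerX.
rewrite IH1 IH2 /wsum !exprS; field.
by rewrite a0 expf_neq0.
Qed.

Lemma size_chebT_monic n : (size (chebT n.+1) <= n.+2)%N /\ (chebT n.+1)`_n.+1 = 1.
Proof.
suff [] : ((size (chebT n) <= n.+1)%N) /\ 
  ((size (chebT n.+1) <= n.+2)%N /\ (chebT n.+1)`_n.+1 = 1) by [].
elim: n => [|n [IH0 [IH1 IH2]]].
  by rewrite /= size_polyX coefX size_polyC_leq1.
split=> //; rewrite [chebT n.+2]/= -/(chebT n.+1); split; last first.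
  by rewrite coefB coefXM /= IH2 nth_default ?subr0 // (leq_trans IH0).
apply: (leq_trans (size_polyD _ _)); rewrite size_polyN geq_max.
rewrite (leq_trans IH0) ?andbT; last by lia.
by apply: (leq_trans (size_polyMleq _ _)); rewrite size_polyX; lia.
Qed.

(** The denominator matrix is the Vandermonde matrix of the w's times the
    triangular matrix of coefficients of the Chebyshev polynomials, whose
    diagonal is 2, 1, ..., 1. *)
Lemma oden_wvander x : (0 < size x)%N -> (forall b, b \in x -> b != 0) ->
  oden x = 2 * wvander x.
Proof.
move=> x_gt0 x0; rewrite /oden.
pose T p j : F := (chebT j)`_p.
have szT j : (size (chebT j) <= j.+1)%N.
  by case: j => [|j]; [exact: size_polyC_leq1 | case: (size_chebT_monic j)].
rewrite (det_mulT (A := fun i p => wsum x`_i ^+ p)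
   (B := fun i j => x`_i ^ (- j.+1%:Z + 1) + x`_i ^ (j.+1%:Z - 1)) (T := T)).
- congr (_ * _).
    case: (size x) x_gt0 => // n _; rewrite big_ord_recl /T /= coefC eqxx.
    rewrite big1 ?mulr1 // => i _.
    by rewrite /bump add1n; case: (size_chebT_monic i).
  pose v : 'rV_(size x) := \row_i wsum x`_i.
  rewrite -det_tr (_ : _^T = Vandermonde (size x) v); last first.
    by apply/matrixP=> i j; rewrite !mxE.
  rewrite det_Vandermonde; apply: eq_bigr => i _; apply: eq_bigr => j _.
  by rewrite !mxE.
- move=> i j lt_i lt_j.
  have xi0 : x`_i != 0 by rewrite x0 ?mem_nth.
  rewrite (_ : j.+1%:Z - 1 = j%:Z); last by lia.
  rewrite (_ : - j.+1%:Z + 1 = - j%:Z); last by lia.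
  rewrite -exprnN -exprnP -chebT_eval // (@horner_coef_wide _ (size x)).
    by apply: eq_bigr => p _; rewrite mulrC.
  exact: leq_trans (szT j) lt_j.
- by right=> i j /andP[lt_ji _]; rewrite /T nth_default // (leq_trans (szT j)).
Qed.

End MixedDeterminant.

(** * A Cauchy-Binet formula for a matrix with extra columns *)

Definition decreasing l M (g : 'I_l -> 'I_M) : bool :=
  sorted gtn (map val (codom g)).

Lemma gtn_trans : transitive gtn.
Proof. by move=> n m p /= nm pn; apply: ltn_trans pn nm. Qed.

Lemma decreasing_inj l M (g : 'I_l -> 'I_M) : decreasing g -> injective g.
Proof.
move=> dg; apply/injectiveP; rewrite /injectiveb /dinjectiveb -(map_inj_uniq val_inj).
by apply: sorted_uniq dg; [apply: gtn_trans | move=> i; rewrite /= ltnn].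
Qed.

(** An injective function becomes decreasing after exactly one permutation of
    its arguments: sorting gives one, and two decreasing sequences with the same
    entries coincide. *)
Lemma sorting_perm l M (f : {ffun 'I_l -> 'I_M}) : injective f ->
  exists s0 : 'S_l, forall s : 'S_l, decreasing (f \o s) = (s == s0).
Proof.
move=> f_inj.
pose t := [tuple f i | i < l].
have cod_t (h : 'I_l -> 'I_M) : codom h = [tuple h i | i < l].
  by rewrite codomE.
pose r0 := sort (fun a b : 'I_M => geq a b) t.
have /tuple_permP[s0 tE] : perm_eq r0 t by rewrite perm_sort.
have r0E : codom (f \o s0) = r0.
  by rewrite tE cod_t; apply: eq_map => i; rewrite /= tnth_mktuple.
have sorted0 : decreasing (f \o s0).
  rewrite /decreasing r0E sorted_map.
  have : sorted (fun a b : 'I_M => geq a b) r0.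
    by apply: sort_sorted => a b; apply: leq_total.
  have : uniq r0 by rewrite sort_uniq -cod_t; apply/injectiveP.
  move: r0 {tE r0E} => r ur sr.
  rewrite sorted_pairwise; last first.
    by move=> a b c /= ba ac; apply: ltn_trans ac ba.
  move: sr; rewrite sorted_pairwise; last first.
    by move=> a b c /= ba ac; apply: leq_trans ac ba.
  elim: r ur => //= a r IHr /andP[ar ur] /andP[ha hr]; rewrite IHr // andbT.
  apply/allP=> b br; have /= := allP ha b br; rewrite leq_eqVlt => /orP[/eqP eba|//].
  by rewrite -(val_inj eba) br in ar.
exists s0 => s; apply/idP/eqP => [ds|->//].
apply/permP => i; apply: f_inj.
suff : codom (f \o s) = codom (f \o s0).
  rewrite !codomE => /eq_in_map /(_ i); apply; exact: mem_enum.
apply: (inj_map val_inj); apply: (irr_sorted_eq gtn_trans) ds sorted0 _ => [a|a].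
  by rewrite /= ltnn.
apply: eq_mem_map => b.
have codf (u : 'S_l) : (b \in codom (f \o u)) = (b \in codom f).
  apply/codomP/codomP => -[c ->]; first by exists (u c).
  by exists ((u^-1)%g c); rewrite /= permKV.
by rewrite !codf.
Qed.

Section CauchyBinet.
Variable R : comNzRingType.

(** By [sorting_perm], each injective f is counted once among the pairs of f and
    a permutation s with f \o s decreasing; reindexing f by s gives the sum. *)
Lemma sum_ffun_decreasing l M (P : {ffun 'I_l -> 'I_M} -> R) :
    (forall f : {ffun 'I_l -> 'I_M}, ~~ injectiveb f -> P f = 0) ->
  \sum_f P f =
  \sum_(g : {ffun 'I_l -> 'I_M} | decreasing g)
     \sum_(s : 'S_l) P [ffun j => g (s j)].
Proof.
move=> P0.
pose pm (s : 'S_l) (f : {ffun 'I_l -> 'I_M}) := [ffun j => f (s j)].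
have pmK s : cancel (pm s) (pm s^-1%g).
  by move=> f; apply/ffunP=> i; rewrite !ffunE permKV.
have pmKV s : cancel (pm s^-1%g) (pm s).
  by move=> f; apply/ffunP=> i; rewrite !ffunE permK.
transitivity (\sum_(f : {ffun 'I_l -> 'I_M})
                \sum_(s : 'S_l | decreasing (f \o s)) P f).
  apply: eq_bigr => f _; have [f_inj|] := boolP (injectiveb f).
    have [s0 s0E] := sorting_perm (injectiveP _ f_inj).
    by rewrite (eq_bigl (pred1 s0)) // big_pred1_eq.
  by move/P0 ->; rewrite big1.
rewrite (exchange_big_dep predT) //= exchange_big /=.
rewrite (reindex_inj invg_inj) /=; apply: eq_bigr => s _.
rewrite (reindex (pm s)) /=; last first.
  by exists (pm s^-1%g) => f _; [apply: pmK | apply: pmKV].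
apply: eq_big => // f; rewrite /decreasing; congr (sorted _ (map _ _)).
by apply: eq_codom => i; rewrite /= ffunE permKV.
Qed.

(** Expanding the first l columns by multilinearity gives a sum over all
    functions f from the columns to the summation range.  A non-injective f
    repeats a column and contributes 0; the permutations of a decreasing f
    only permute these columns, and their signs build up the minor of C. *)
Lemma cauchy_binet_bordered l k M (A : 'M[R]_(l + k, M)) (C : 'M_(M, l))
    (B : 'M_(l + k, k)) :
  \det (row_mx (A *m C) B) =
  \sum_(g : {ffun 'I_l -> 'I_M} | decreasing g)
     \det (rowsub g C) * \det (row_mx (colsub g A) B).
Proof.
pose D (g : 'I_l -> 'I_M) := \det (row_mx (colsub g A) B).
transitivity (\sum_(f : {ffun 'I_l -> 'I_M}) (\prod_j C (f j) j) * D f).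
  have detE (E : 'M[R]_(l + k, l)) : \det (row_mx E B) = \sum_(s : 'S_(l + k))
      (-1) ^+ s * ((\prod_i E (s (lshift k i)) i) * \prod_i B (s (rshift l i)) i).
    rewrite -det_tr; apply: eq_bigr => s _; rewrite big_split_ord /=.
    by congr (_ * (_ * _)); apply: eq_bigr => i _; rewrite mxE ?row_mxEl ?row_mxEr.
  under [RHS]eq_bigr => f _ do rewrite /D detE mulr_sumr.
  rewrite detE exchange_big /=; apply: eq_bigr => s _.
  under eq_bigr => i _ do rewrite mxE.
  rewrite bigA_distr_bigA /= mulr_suml mulr_sumr; apply: eq_bigr => f _.
  rewrite big_split /=.
  under [X in _ = _ * (_ * (X * _))]eq_bigr => i _ do rewrite mxE.
  by rewrite [RHS]mulrCA [X in _ = _ * X]mulrA [X in _ = _ * (X * _)]mulrC.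
rewrite sum_ffun_decreasing => [|f /injectivePn[i1 [i2 ne12 eq12]]]; last first.
  rewrite /D -det_tr.
  rewrite (determinant_alternate (i1 := lshift k i1) (i2 := lshift k i2)) ?mulr0 //.
  by move=> i; rewrite mxE row_mxEl mxE [RHS]mxE row_mxEl mxE eq12.
apply: eq_bigr => g dg; rewrite /determinant mulr_suml.
rewrite (reindex_inj invg_inj) /=; apply: eq_bigr => s _.
have -> : D [ffun j => g ((s^-1)%g j)] = (-1) ^+ s * D g.
  rewrite /D; have -> : row_mx (colsub [ffun j => g ((s^-1)%g j)] A) B =
     row_mx (colsub g A) B *m block_mx (perm_mx s) 0 0 1%:M.
    rewrite mul_row_block !mulmx0 mulmx1 addr0 add0r; congr row_mx.
    rewrite -[s in perm_mx s]invgK -col_permE.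
    by apply/matrixP=> i j; rewrite !mxE ffunE.
  by rewrite det_mulmx det_ublock det1 mulr1 det_perm mulrC.
rewrite [LHS]mulrA [_ * (-1) ^+ s]mulrC; congr (_ * _ * _).
rewrite [LHS](reindex_inj (@perm_inj _ s)) /=; apply: eq_bigr => i _.
by rewrite ffunE permK mxE.
Qed.
End CauchyBinet.

(** * Partitions as decreasing exponents, and the determinants of the theorem *)

Section Branching.
Variable F : fieldType.
Implicit Types (x y : seq F) (a b : F) (lam : seq nat).

Lemma nth_codom_ord l M (g : 'I_l -> 'I_M) (i : 'I_l) :
  nth 0%N (map val (codom g)) i = g i.
Proof. by rewrite codomE -map_comp (nth_map i) ?size_enum_ord // nth_ord_enum. Qed.

Lemma decreasingP l M (g : 'I_l -> 'I_M) :
  reflect (forall i j : 'I_l, j = i.+1 :> nat -> (g j < g i)%N) (decreasing g).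
Proof.
have sz : size (map val (codom g)) = l by rewrite size_map size_codom card_ord.
apply: (iffP (sortedP 0%N)) => dg.
  move=> i j ji; have := dg i; rewrite sz -ji ltn_ord !nth_codom_ord; exact.
move=> i; rewrite sz => lt_il.
have := dg (Ordinal (ltnW lt_il)) (Ordinal lt_il) erefl.
by rewrite -!nth_codom_ord.
Qed.

Lemma decreasing_geq l M (g : 'I_l -> 'I_M) (i : 'I_l) :
  decreasing g -> (l - i.+1 <= g i)%N.
Proof.
move=> /decreasingP dg; have [d] := ubnP (l - i)%N.
elim: d i => // d IHd i lt_d.
have := ltn_ord i; rewrite leq_eqVlt => /orP[/eqP il|lt_il].
  by rewrite il subnn.
have := IHd (Ordinal lt_il); have := dg i (Ordinal lt_il) erefl; rewrite /=; lia.
Qed.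

(** Inverse to mu |-> (mu_j + l - j)_j, with the index j starting at 1. *)
Definition shape_of l M (g : 'I_l -> 'I_M) : l.-tuple nat :=
  [tuple (g j - (l - j.+1))%N | j < l].

Lemma nth_shape_of l M (g : 'I_l -> 'I_M) (i : 'I_l) :
  nth 0%N (shape_of g) i = (g i - (l - i.+1))%N.
Proof. by rewrite -tnth_nth tnth_mktuple. Qed.

Lemma gpartition_shape_of l M (g : 'I_l -> 'I_M) :
  decreasing g -> gpartition (shape_of g).
Proof.
move=> dg; apply/(sortedP 0%N) => i; rewrite size_tuple => lt_il.
have := nth_shape_of g (Ordinal (ltnW lt_il)).
have := nth_shape_of g (Ordinal lt_il).
have := decreasing_geq (Ordinal lt_il) dg.
move/decreasingP: dg => /(_ (Ordinal (ltnW lt_il)) (Ordinal lt_il) erefl).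
by rewrite /= => lt_g ge_g -> ->; lia.
Qed.

Lemma shape_of_inj l M : {in [pred g : {ffun 'I_l -> 'I_M} | decreasing g] &,
  injective (fun g : {ffun 'I_l -> 'I_M} => shape_of g)}.
Proof.
move=> g h dg dh gh; apply/ffunP => i; apply: val_inj.
have := nth_shape_of g i; rewrite gh nth_shape_of.
have := decreasing_geq i dg; have := decreasing_geq i dh; rewrite /=; lia.
Qed.

Lemma shape_of_surj l M (mu : l.-tuple nat) : gpartition mu ->
    (nth 0%N mu 0 + l <= M)%N ->
  exists2 g : {ffun 'I_l -> 'I_M}, decreasing g & shape_of g = mu.
Proof.
move=> mu_part le_M.
have mu_mono i j : (i <= j)%N -> (j < l)%N -> (nth 0%N mu j <= nth 0%N mu i)%N.
  move=> le_ij lt_jl; apply: (sorted_leq_nth _ _ 0%N mu_part);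
    rewrite ?inE ?size_tuple //.
  - by move=> p q r /= pq qr; apply: leq_trans qr pq.
  - exact: leqnn.
  - exact: leq_ltn_trans lt_jl.
have lt_M (j : 'I_l) : (nth 0%N mu j + (l - j.+1) < M)%N.
  have := mu_mono 0%N j (leq0n _) (ltn_ord j); have := ltn_ord j; lia.
pose g := [ffun j : 'I_l => Ordinal (lt_M j)].
exists g.
  apply/decreasingP => i j ji; rewrite !ffunE /=.
  have := mu_mono i j; have := ltn_ord j; lia.
apply: eq_from_tnth => i; rewrite (tnth_nth 0%N) nth_shape_of ffunE /= addnK.
by rewrite (tnth_nth 0%N).
Qed.

(** The exponent mu_j - j + l is 0 only for the last j, with mu_j = 0, which is
    where the epsilon vanishes. *)
Lemma onum_csym mu x l : size x = l -> (forall b, b \in x -> b != 0) ->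
  onum mu x = \det (\matrix_(i < l, j < l) csym x`_i (nth 0%N mu j + (l - j.+1))).
Proof.
move=> <- x0; congr (\det _); apply/matrixP=> i j; rewrite !mxE /csym /part.
set e : int := _ + (size x)%:Z.
have -> : e = (nth 0%N mu j + (size x - j.+1))%N%:Z.
  by rewrite /e; have := ltn_ord j; lia.
rewrite -exprnN -exprnP.
have -> : ((j.+1 == size x) && ((nth 0%N mu j)%:Z == 0))
        = (nth 0%N mu j + (size x - j.+1) == 0)%N.
  have := ltn_ord j; lia.
case: eqP => [->|_]; last by rewrite mul1r.
by rewrite expr0 invr1 mul0r addr0.
Qed.

Lemma onum_mixdet lam x : (forall b, b \in x -> b != 0) ->
  onum lam x = mixdet (fun i => part lam i - i.+1%:Z + (size x)%:Z) x [::].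
Proof.
move=> x0; rewrite (onum_csym _ (esym (addn0 (size x)))) // -[RHS]det_tr.
congr (\det _); apply/matrixP=> j i; rewrite !mxE /mixcol.
have lt_i := ltn_ord i; have lt_jx : (j < size x)%N by have := ltn_ord j; lia.
rewrite lt_jx -csym_hpm ?x0 ?mem_nth // /part /=.
have -> : (nth 0%N lam i)%:Z - i.+1%:Z + (size x)%:Z - 0%:Z =
  (nth 0%N lam i + (size x + 0 - i.+1))%N%:Z by lia.
by [].
Qed.

(** The mixed determinant with the normalization of [oschur]; for y empty and the
    exponents of lam it is the orthogonal Schur function itself. *)
Definition schur_mix (e : nat -> int) x y : F :=
  2 * (-1) ^+ ((size x * (size x - 1)) %/ 2) * (mixdet e x y / oden x).

(** The factors w_b - w_a of the determinant and w_a - w_b of the denominator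
    differ by (-1)^(size x), as do the signs in front of the two quotients. *)
Lemma schur_mix_rcons e x y a : (0 < size x)%N ->
    (forall b, b \in rcons x a -> b != 0) -> oden (rcons x a) != 0 ->
  oden x != 0 /\ schur_mix e (rcons x a) y = schur_mix e x (a :: y).
Proof.
move=> x_gt0 xa0; have a0 : a != 0 by rewrite xa0 // mem_rcons mem_head.
have x0 b : b \in x -> b != 0 by move=> bx; rewrite xa0 // mem_rcons inE bx orbT.
have odenE : oden (rcons x a) = oden x * \prod_(b <- x) (wsum a - wsum b).
  by rewrite !oden_wvander ?size_rcons // wvander_rcons mulrA.
rewrite odenE mulf_eq0 negb_or => /andP[den0 prod0]; split=> //.
rewrite /schur_mix odenE mixdet_rcons //.
have -> : \prod_(b <- x) (wsum b - wsum a)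
    = (-1) ^+ size x * \prod_(b <- x) (wsum a - wsum b).
  under eq_bigr => b _ do rewrite -opprB -mulN1r.
  by rewrite big_split /= big_const_seq count_predT iter_mulr_1.
have -> : ((size (rcons x a) * (size (rcons x a) - 1)) %/ 2
   = (size x * (size x - 1)) %/ 2 + size x)%N.
  rewrite size_rcons; case: (size x) => // n.
  by rewrite addnC -divnMDl //; congr (_ %/ _)%N; nia.
have sgn2 : (-1) ^+ size x * (-1) ^+ size x = 1 :> F.
  by rewrite -exprMn mulrNN mulr1 expr1n.
rewrite exprD -[RHS]mul1r -[X in _ = X * _]sgn2; field; exact/andP.
Qed.

Lemma schur_mix_nil e x y : (0 < size x)%N ->
    (forall b, b \in x ++ y -> b != 0) -> oden (x ++ y) != 0 ->
  oden x != 0 /\ schur_mix e (x ++ y) [::] = schur_mix e x y.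
Proof.
elim: y x => [|a y IHy] x x_gt0; first by rewrite cats0.
rewrite -cat_rcons => xy0 den0.
have [|den_xa0 ->] := IHy (rcons x a) _ xy0 den0; first by rewrite size_rcons.
apply: schur_mix_rcons => // b bxa; apply: xy0; by rewrite mem_cat bxa.
Qed.

Lemma leq_sumn (s : seq nat) i : (nth 0%N s i <= sumn s)%N.
Proof. elim: s i => [|a s IHs] [|i] //=; [lia | have := IHs i; lia]. Qed.

Lemma oskew_bordered lam mu y l k : size mu = l -> size y = k ->
  oskew lam mu y = \det (row_mx
    (\matrix_(i < l + k, j < l) hpm y (part lam i - i.+1%:Z + l%:Z
        - (nth 0%N mu j + (l - j.+1))%N%:Z))
    (\matrix_(i < l + k, s < k) (hpm y (part lam i - i.+1%:Z + l%:Z + s.+1%:Z)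
        - hpm y (part lam i - i.+1%:Z + l%:Z - s.+1%:Z)))).
Proof.
move=> <- <-; congr (\det _); apply/matrixP=> i j; rewrite mxE.
case: (splitP j) => [j' jj'|s js].
  rewrite (_ : j = lshift _ j') ?row_mxEl ?mxE; last exact: val_inj.
  by have lt_j := ltn_ord j'; rewrite /part /=; congr (hpm _ _); lia.
rewrite (_ : j = rshift _ s) ?row_mxEr ?mxE; last exact: val_inj.
by rewrite /=; congr (hpm _ _ - hpm _ _); lia.
Qed.

(** The first column vanishes: its indices lam_i - mu_1 - i + 1 are negative.
    This is what makes the sum over mu finite. *)
Lemma oskew_eq0 lam mu y : (0 < size mu)%N -> (sumn lam < nth 0%N mu 0)%N ->
  oskew lam mu y = 0.
Proof.
move=> mu_gt0 lt_mu.
rewrite (oskew_bordered lam (erefl (size mu)) (erefl (size y))).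
rewrite (expand_det_col _ (lshift _ (Ordinal mu_gt0))) big1 // => i _.
rewrite row_mxEl mxE hpm_neg ?mul0r // /part /=.
have := leq_sumn lam i; lia.
Qed.

Lemma mixdet_sized e x y l k : size x = l -> size y = k ->
  mixdet e x y =
  \det (\matrix_(i < l + k, j < l + k) mixcol x y j (e i - k%:Z)).
Proof. by move=> <- <-. Qed.

(** The truncation M only has to exceed every index lam_i - i + l, so that all
    nonzero h_{lam_i - i + l - e}(y) with e >= 0 have e < M. *)
Lemma mixdet_branching l k (lam : seq nat) (x : l.-tuple F) (y : k.-tuple F) M :
    (forall b, b \in x -> b != 0) -> (sumn lam + l <= M)%N ->
  mixdet (fun i => part lam i - i.+1%:Z + (l + k)%N%:Z) x y =
  \sum_(g : {ffun 'I_l -> 'I_M} | decreasing g)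
     onum (shape_of g) x * oskew lam (shape_of g) y.
Proof.
move=> x0 le_M.
pose m i : int := part lam i - i.+1%:Z + l%:Z.
pose A : 'M_(l + k, M) := \matrix_(i, e) hpm y (m i - e%:Z).
pose B : 'M_(l + k, k) :=
  \matrix_(i, s) (hpm y (m i + s.+1%:Z) - hpm y (m i - s.+1%:Z)).
pose C : 'M_(M, l) := \matrix_(e, j) csym x`_j e.
transitivity (\det (row_mx (A *m C) B)).
  have sx := size_tuple x; rewrite (mixdet_sized _ sx (size_tuple y)).
  congr (\det _); apply/matrixP=> i j; rewrite mxE /mixcol sx.
  rewrite (_ : part lam i - i.+1%:Z + (l + k)%N%:Z - k%:Z = m i);
    last by rewrite /m; lia.
  case: (splitP j) => [j' jj'|s js].
    rewrite (_ : j = lshift _ j') ?row_mxEl ?mxE; last exact: val_inj.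
    rewrite /= -(@hpm_cons_conv _ _ _ _ M); last first.
    - rewrite /m /part; have := leq_sumn lam i; lia.
    - by rewrite x0 // mem_nth // sx.
    by apply: eq_bigr => e _; rewrite !mxE mulrC.
  rewrite (_ : j = rshift _ s) ?row_mxEr ?mxE; last exact: val_inj.
  by rewrite /=; congr (hpm _ _ - hpm _ _); lia.
rewrite cauchy_binet_bordered; apply: eq_bigr => g dg.
have gE (j : 'I_l) : (nth 0%N (shape_of g) j + (l - j.+1) = g j)%N.
  by rewrite nth_shape_of subnK // decreasing_geq.
congr (_ * _).
  rewrite (onum_csym _ (size_tuple x)) // -det_tr; congr (\det _).
  by apply/matrixP=> i j; rewrite !mxE gE.
rewrite (oskew_bordered lam (size_tuple (shape_of g)) (size_tuple y)).
congr (\det (row_mx _ _)).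
by apply/matrixP=> i j; rewrite !mxE gE.
Qed.
End Branching.

(* The variables are arbitrary nonzero elements of a field at which the quotient
   defining oschur lam (x ++ y) makes sense: oden (x ++ y) != 0 means that 2 is
   invertible and that the z + z^-1, for z in x ++ y, are pairwise distinct; in
   particular oden x != 0.  Taking for F the field of rational functions in n
   indeterminates gives the identity for indeterminates.
   As \sum_(mu \in A) is 0 by convention when the support is infinite, the
   finiteness of the support is part of the conclusion. *)
Theorem proposition3p9 (F : fieldType) (n k : nat)
    (k_ge1 : (1 <= k)%N) (k_ltn : (k < n)%N)
    (lam : n.-tuple nat) (lam_part : gpartition lam)
    (x : (n - k).-tuple F) (y : k.-tuple F)
    (xy_neq0 : forall z : F, z \in x ++ y -> z != 0)
    (xy_generic : oden (x ++ y) != 0) :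
  finite_set [set mu : (n - k).-tuple nat |
                gpartition mu /\ oschur mu x * oskew lam mu y <> 0] /\
  oschur lam (x ++ y) =
    \sum_(mu \in [set mu : (n - k).-tuple nat | gpartition mu])
      (oschur mu x * oskew lam mu y).
Proof.
set l := (n - k)%N in x xy_neq0 xy_generic *.
have l_gt0 : (0 < l)%N by rewrite subn_gt0.
(* M bounds mu_1 + l for every mu with a nonzero skew factor. *)
pose M := (sumn lam + l)%N.
pose r := [seq shape_of g | g : {ffun 'I_l -> 'I_M} in
  [pred g : {ffun 'I_l -> 'I_M} | decreasing g]].
have r_part (mu : l.-tuple nat) : mu \in r -> gpartition mu.
  by case/mapP=> g; rewrite mem_enum => dg ->; apply: gpartition_shape_of.
have r_supp (mu : l.-tuple nat) : gpartition mu -> mu \notin r ->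
    oschur mu x * oskew lam mu y = 0.
  move=> mu_part mu_r; rewrite (@oskew_eq0 _ lam mu y) ?mulr0 ?size_tuple // ltnNge.
  apply: contra mu_r => le_mu.
  have [|g dg <-] := @shape_of_surj l M mu mu_part; first by rewrite leq_add2r.
  by apply: map_f; rewrite mem_enum.
split.
  apply: (sub_finite_set _ (finite_seq r)) => mu /= [mu_part mu_n0].
  by apply: contra_notT mu_n0 => /(r_supp _ mu_part).
rewrite (fsbigE r); first 1 last.
- rewrite map_inj_in_uniq ?enum_uniq // => g h.
  by rewrite !mem_enum; apply: shape_of_inj.
- exact: r_part.
- exact: r_supp.
transitivity (\sum_(mu <- r) oschur mu x * oskew lam mu y); last first.
  rewrite [RHS]big_mkcond big_seq [RHS]big_seq.
  apply: eq_bigr => mu /r_part mu_part; by rewrite ifT // inE.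
rewrite big_image /=.
pose e i : int := part lam i - i.+1%:Z + (l + k)%N%:Z.
have sz_xy : size (x ++ y) = (l + k)%N by rewrite size_cat !size_tuple.
have [|_ mixE] := @schur_mix_nil F e x y _ xy_neq0 xy_generic.
  by rewrite size_tuple.
have -> : oschur lam (x ++ y) = schur_mix e (x ++ y) [::].
  by rewrite /oschur /schur_mix onum_mixdet // sz_xy.
have x_neq0 b : b \in x -> b != 0 by move=> bx; rewrite xy_neq0 // mem_cat bx.
rewrite mixE /schur_mix (mixdet_branching y x_neq0 (leqnn M)).
rewrite mulr_suml mulr_sumr; apply: eq_bigr => g _.
rewrite /oschur; ring.
Qed.
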